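(* Let $p$ be a prime number. If $A$ is a $p$-ring with $p=0$, then every element of $A$ can be explicitly written as a $\mathbb{Z}$-linear combination of idempotent elements. In particular, $A$ is commutative by an equational proof.
   Context: Rings are associative and unital, not necessarily commutative; the zero ring is allowed. For an integer $n>1$, an $n$-ring is a ring in which $x^n=x$ holds for every element $x$. ''With $p=0$'' means $p\cdot 1_A=0$. An element $e$ is idempotent if $e^2=e$. Equational proofs. An algebraic theory $\mathcal{T}$ is given by operation symbols of finite arities and a set of axioms, each an equation between terms. An equational proof of $\sigma=\tau$ in $\mathcal{T}$ (written $\mathcal{T}\vdash\sigma=\tau$) is a deduction by the rules: (1) if $\sigma=\tau$ is an axiom then $\mathcal{T}\vdash\sigma=\tau$; (2) $\mathcal{T}\vdash\sigma=\sigma$; (3) if $\mathcal{T}\vdash\sigma=\tau$ then $\mathcal{T}\vdash\tau=\sigma$; (4) if $\mathcal{T}\vdash\sigma=\tau$ and $\mathcal{T}\vdash\tau=\rho$ then $\mathcal{T}\vdash\sigma=\rho$; (5) if $\rho$ is a term of arity $r$ and $\mathcal{T}\vdash\sigma_i=\tau_i$ for $i=1,\dots,r$, then $\mathcal{T}\vdash\rho(\sigma_1,\dots,\sigma_r)=\rho(\tau_1,\dots,\tau_r)$; (6) if $\sigma,\tau$ are terms of arity $r$ with $\mathcal{T}\vdash\sigma=\tau$, then $\mathcal{T}\vdash\sigma(\rho_1,\dots,\rho_r)=\tau(\rho_1,\dots,\rho_r)$ for all terms $\rho_1,\dots,\rho_r$. The theory of $p$-rings with $p=0$ consists of the ring axioms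 (operations $+,-,0,\cdot,1$) together with the axioms $x^p=x$ and $p\cdot 1=0$. ''$A$ is commutative by an equational proof'' means that this theory proves $xy=yx$ for two distinct variables $x,y$. *)

(* Defs.v *)
From HB Require Import structures.
From mathcomp Require Import all_boot all_order all_algebra.

Set Implicit Arguments.
Unset Strict Implicit.
Unset Printing Implicit Defensive.

Import GRing.Theory.
Local Open Scope ring_scope.

Record signature : Type := Signature { op : Type; op_arity : op -> nat }.

(* [term S r] is the type of terms of arity [r], that is, of terms whose
   variables are among [r] given ones, indexed by ['I_r]. *)
Inductive term (S : signature) (r : nat) : Type :=
| Var : 'I_r -> term S r
| App : forall f : op S, ('I_(op_arity f) -> term S r) -> term S r.

Arguments Var {S r} i.
Arguments App {S r} f args.

Fixpoint subst (S : signature) (r m : nat) (t : term S r)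
    (rho : 'I_r -> term S m) : term S m :=
  match t with
  | Var i => rho i
  | App f args => App f (fun i => subst (args i) rho)
  end.

Fixpoint eval (S : signature) (A : Type)
    (I : forall f : op S, ('I_(op_arity f) -> A) -> A)
    (r : nat) (a : 'I_r -> A) (t : term S r) : A :=
  match t with
  | Var i => a i
  | App f args => I f (fun i => eval I a (args i))
  end.

(* The axioms of a theory: [T r s t] means that the equation [s = t] between
   terms of arity [r] is an axiom. *)
Definition theory (S : signature) : Type :=
  forall r : nat, term S r -> term S r -> Prop.

Inductive proves (S : signature) (T : theory S) :
    forall r : nat, term S r -> term S r -> Prop :=
| proves_axiom r (s t : term S r) : T r s t -> proves T s t
| proves_refl r (s : term S r) : proves T s s
| proves_sym r (s t : term S r) : proves T s t -> proves T t s
| proves_trans r (s t u : term S r) :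
    proves T s t -> proves T t u -> proves T s u
| proves_congr r m (rho : term S r) (s t : 'I_r -> term S m) :
    (forall i, proves T (s i) (t i)) -> proves T (subst rho s) (subst rho t)
| proves_subst r m (s t : term S r) (rho : 'I_r -> term S m) :
    proves T s t -> proves T (subst s rho) (subst t rho).

Inductive ring_op : Type := OpAdd | OpOpp | OpZero | OpMul | OpOne.

Definition ring_op_arity (f : ring_op) : nat :=
  match f with
  | OpAdd => 2
  | OpOpp => 1
  | OpZero => 0
  | OpMul => 2
  | OpOne => 0
  end.

Definition ring_sig : signature := Signature ring_op_arity.

Definition ring_term (r : nat) : Type := term ring_sig r.

Section RingTerms.
Variable r : nat.
Implicit Types s t : ring_term r.

Definition tadd s t : ring_term r := @App ring_sig r OpAdd (tnth [tuple s; t]).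
Definition topp t : ring_term r := @App ring_sig r OpOpp (tnth [tuple t]).
Definition tzero : ring_term r := @App ring_sig r OpZero (tnth [tuple]).
Definition tmul s t : ring_term r := @App ring_sig r OpMul (tnth [tuple s; t]).
Definition tone : ring_term r := @App ring_sig r OpOne (tnth [tuple]).

Definition texp t (n : nat) : ring_term r := iter n (tmul t) tone.
Definition tnatmul t (n : nat) : ring_term r := iter n (tadd t) tzero.

End RingTerms.

Arguments tzero {r}.
Arguments tone {r}.

Declare Scope ring_term_scope.
Delimit Scope ring_term_scope with rt.
Bind Scope ring_term_scope with ring_term.
Notation "s + t" := (tadd s t) : ring_term_scope.
Notation "- t" := (topp t) : ring_term_scope.
Notation "0" := tzero : ring_term_scope.
Notation "s * t" := (tmul s t) : ring_term_scope.
Notation "1" := tone : ring_term_scope.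
Notation "t ^+ n" := (texp t n) : ring_term_scope.
Notation "t *+ n" := (tnatmul t n) : ring_term_scope.

Definition ring_interp (A : pzRingType) (f : op ring_sig) :
    ('I_(op_arity f) -> A) -> A :=
  match f return ('I_(ring_op_arity f) -> A) -> A with
  | OpAdd => fun a => a ord0 + a ord_max
  | OpOpp => fun a => - a ord0
  | OpZero => fun _ => 0
  | OpMul => fun a => a ord0 * a ord_max
  | OpOne => fun _ => 1
  end.

Definition reval (A : pzRingType) (r : nat) (a : 'I_r -> A) (t : ring_term r) :
    A :=
  eval (@ring_interp A) a t.

Definition tvar (r k : nat) (lt_kr : (k < r)%N) : ring_term r :=
  Var (Ordinal lt_kr).

Local Notation x1 := (@tvar 1 0 isT).
Local Notation x2 := (@tvar 2 0 isT).
Local Notation y2 := (@tvar 2 1 isT).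
Local Notation x3 := (@tvar 3 0 isT).
Local Notation y3 := (@tvar 3 1 isT).
Local Notation z3 := (@tvar 3 2 isT).

Inductive ring_theory : theory ring_sig :=
| ring_addA : ring_theory (x3 + (y3 + z3))%rt ((x3 + y3) + z3)%rt
| ring_addC : ring_theory (x2 + y2)%rt (y2 + x2)%rt
| ring_add0 : ring_theory (0 + x1)%rt x1
| ring_addN : ring_theory (- x1 + x1)%rt 0%rt
| ring_mulA : ring_theory (x3 * (y3 * z3))%rt ((x3 * y3) * z3)%rt
| ring_mul1l : ring_theory (1 * x1)%rt x1
| ring_mul1r : ring_theory (x1 * 1)%rt x1
| ring_mulDl : ring_theory ((x3 + y3) * z3)%rt (x3 * z3 + y3 * z3)%rt
| ring_mulDr : ring_theory (x3 * (y3 + z3))%rt (x3 * y3 + x3 * z3)%rt.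

Inductive p_ring_theory (p : nat) : theory ring_sig :=
| p_ring_ring r (s t : ring_term r) : ring_theory s t -> p_ring_theory p s t
| p_ring_exp : p_ring_theory p (x1 ^+ p)%rt x1
| p_ring_char : p_ring_theory p (1 *+ p : ring_term 0)%rt 0%rt.

Definition n_ring (n : nat) (A : pzRingType) : Prop :=
  (1 < n)%N /\ forall x : A, x ^+ n = x.

Definition idempotent_elt (A : pzRingType) (e : A) : Prop := e ^+ 2 = e.

(* Main.v *)
(* For c in F_p the element e_c = 1 - (x - c)^(p-1) is idempotent because
   y^p = y, and x is the sum of the c e_c: the polynomial
   sum_c c (1 - (X - c)^(p-1)) - X over F_p has degree less than p and vanishes
   on F_p by Fermat, hence is zero.  A p-ring is reduced, so its idempotents are
   central and the ring is commutative.  By completeness of equational logic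
   (terms modulo provable equality form a model) commutativity has an equational
   proof. *)
From HB Require Import structures.
Require Import Defs.
From mathcomp Require Import all_boot all_order all_algebra.
From mathcomp Require Import finfield boolp.

Set Implicit Arguments.
Unset Strict Implicit.
Unset Printing Implicit Defensive.

Import GRing.Theory.
Local Open Scope ring_scope.

(** * Interpolation over the prime field and the decomposition into idempotents *)

(** Over ['F_p] this is the Lagrange interpolant of the identity at all points, minus ['X]. The
    coefficient ring is a parameter so that the formula over [int] can be both reduced modulo [p]
    and evaluated in [A]. *)
Definition interpolation_poly (R : nzRingType) (p : nat) : {poly R} :=
  \sum_(i < p) (1 - ('X - i%:R) ^+ p.-1) *+ i - 'X.

Lemma size_interpolation_poly (R : nzRingType) (p : nat) :
  (1 < p)%N -> (size (interpolation_poly R p) <= p)%N.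
Proof.
move=> p_gt1; rewrite /interpolation_poly.
apply: leq_trans (size_polyD _ _) _; rewrite geq_max size_polyN size_polyX p_gt1.
rewrite andbT; apply: leq_trans (size_sum _ _ _) _; apply/bigmax_leqP => i _.
rewrite -scaler_nat; apply: leq_trans (size_scale_leq _ _) _.
apply: leq_trans (size_polyD _ _) _; rewrite geq_max size_polyN size_poly1.
by rewrite (ltnW p_gt1) -polyC_natr size_exp_XsubC prednK ?(ltnW p_gt1) /=.
Qed.

Lemma interpolation_poly_Fp (p : nat) :
  prime p -> interpolation_poly 'F_p p = 0.
Proof.
move=> p_pr; have p_gt1 := prime_gt1 p_pr.
apply: (@roots_geq_poly_eq0 _ _ (enum 'F_p)); rewrite ?enum_uniq //; last first.
  by rewrite -cardE card_Fp // size_interpolation_poly.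
apply/allP => d _; rewrite /root /interpolation_poly.
rewrite !hornerE horner_sum.
have lt_dp : (d < p)%N by have := ltn_ord d; rewrite [X in (_ < X)%N]Fp_cast.
(* At [d] only the summand of index [d] survives; its value is [d] because [p.-1] is positive, so
   that [0 ^+ p.-1 = 0]. *)
rewrite (bigD1 (Ordinal lt_dp)) //= big1 => [|i].
  rewrite hornerMn !hornerE -polyC_natr hornerC natr_Zp subrr expr0n.
  case: p p_gt1 {p_pr lt_dp} d => [|[|q]] // _ d.
  by rewrite subr0 natr_Zp subrr.
move=> ne_id; rewrite hornerMn !hornerE -polyC_natr hornerC.
have nz : d - i%:R != 0 :> 'F_p.
  apply: contraNneq ne_id => /subr0_eq d_i; apply/eqP/val_inj => /=.
  by rewrite d_i val_Fp_nat // modn_small.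
suff -> : (d - i%:R) ^+ p.-1 = 1 by rewrite subrr mul0rn.
apply: (mulfI nz); rewrite -exprS prednK ?(ltnW p_gt1) // mulr1.
by have := expf_card (d - i%:R : 'F_p); rewrite card_Fp.
Qed.

(* Polynomials require a nonzero coefficient ring, so the zero ring is treated
   apart. *)
Lemma idempotent_decomposition (p : nat) (A : pzRingType) (x : A) :
  prime p -> p%:R = 0 :> A ->
  x = \sum_(i < p) (1 - (x - i%:R) ^+ p.-1) *+ i.
Proof.
move=> p_pr pA; have [A0|A_nz] := eqVneq (1 : A) 0.
  by rewrite -[LHS]mulr1 -[RHS]mulr1 A0 !mulr0.
pose B : nzRingType := HB.pack A (GRing.PzSemiRing_isNonZero.Build A A_nz).
(* Integers are central, so evaluating integer polynomials at [x] is a ring morphism even before [A]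
   is known to be commutative. *)
have cx : commr_rmorph (intr : int -> B) x by move=> n; apply: commr_int.
have PB0 : map_poly (intr : int -> B) (interpolation_poly int p) = 0.
  apply/polyP => k; rewrite coef_map coef0 /=.
  (* Each integer coefficient vanishes in ['F_p], hence is a multiple of [p], which is zero in
     [A]. *)
  have /dvdzP[q ->] : (p %| (interpolation_poly int p)`_k)%Z.
    rewrite (dvdz_pcharf (pchar_Fp p_pr)).
    rewrite -(coef_map intr) /interpolation_poly rmorphB rmorph_sum /= map_polyX.
    under eq_bigr do rewrite rmorphMn rmorphB rmorph1 rmorphXn rmorphB /=
      map_polyX rmorph_nat.
    by rewrite -/(interpolation_poly 'F_p p) interpolation_poly_Fp // coef0.
  by rewrite intrM -pmulrn [p%:R]pA mulr0.
have : horner_morph cx (interpolation_poly int p) = 0.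
  by rewrite /horner_morph PB0 horner0.
rewrite /interpolation_poly rmorphB rmorph_sum /= horner_morphX.
under eq_bigr do rewrite rmorphMn rmorphB rmorph1 rmorphXn rmorphB /=
  horner_morphX rmorph_nat.
by move/subr0_eq.
Qed.

(** * Idempotents of [n]-rings and commutativity *)

Section NRing.
Variables (n : nat) (A : pzRingType) (nA : n_ring n A).

(** As [n] is at least 2, [y = y ^+ n] has the factor [y ^+ 2]. *)
Lemma n_ring_sqr_eq0 (y : A) : y ^+ 2 = 0 -> y = 0.
Proof.
case: nA => n_gt1 expn y2; rewrite -(expn y) -(subnKC n_gt1) exprD y2.
by rewrite mul0r.
Qed.

(** The square is [y ^+ (n - 2) * y ^+ n = y ^+ (n - 2) * y]. *)
Lemma n_ring_idempotent_exp (y : A) : idempotent_elt (y ^+ n.-1).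
Proof.
case: nA => n_gt1 expn; rewrite /idempotent_elt.
case: n n_gt1 expn => [|[|m]] //= _ expn.
by rewrite expr2 -exprD addSnnS exprD expn -exprSr.
Qed.

(** Both [e * a * (1 - e)] and [(1 - e) * a * e] square to zero, hence vanish, so
    [e * a = e * a * e = a * e]. *)
Lemma n_ring_idempotent_central (e a : A) :
  idempotent_elt e -> GRing.comm e a.
Proof.
rewrite /idempotent_elt expr2 => ee.
have eC : e * (1 - e) = 0 by rewrite mulrBr mulr1 ee subrr.
have Ce : (1 - e) * e = 0 by rewrite mulrBl mul1r ee subrr.
have /n_ring_sqr_eq0 : (e * a * (1 - e)) ^+ 2 = 0.
  by rewrite expr2 !mulrA -(mulrA (e * a)) Ce mulr0 !mul0r.
have /n_ring_sqr_eq0 : ((1 - e) * a * e) ^+ 2 = 0.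
  by rewrite expr2 !mulrA -(mulrA ((1 - e) * a)) eC mulr0 !mul0r.
rewrite mulrBl mul1r mulrBl mulrBr mulr1 => /subr0_eq aee /subr0_eq ea.
by rewrite /GRing.comm ea aee.
Qed.

End NRing.

Lemma idempotent_compl (A : pzRingType) (e : A) :
  idempotent_elt e -> idempotent_elt (1 - e).
Proof.
rewrite /idempotent_elt !expr2 => ee.
by rewrite mulrBr mulr1 mulrBl mul1r ee subrr subr0.
Qed.

Lemma p_ring_comm (p : nat) (A : pzRingType) (x y : A) :
  prime p -> n_ring p A -> p%:R = 0 :> A -> x * y = y * x.
Proof.
move=> p_pr nA pA; rewrite (idempotent_decomposition x p_pr pA) mulr_suml mulr_sumr.
apply: eq_bigr => i _; rewrite mulrnAl mulrnAr; congr (_ *+ _).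
apply: (n_ring_idempotent_central nA); apply: idempotent_compl.
exact: n_ring_idempotent_exp.
Qed.

(** * Terms modulo provable equality, for an arbitrary theory *)

Section TermModel.
Variables (S : signature) (T : theory S) (r : nat).

Lemma proves_app m (f : op S) (s t : 'I_(op_arity f) -> term S m) :
  (forall i, proves T (s i) (t i)) -> proves T (App f s) (App f t).
Proof. exact: (@proves_congr S T _ m (App f Var) s t). Qed.

(** The quotient construction asks for a boolean relation on a choice type; classical logic supplies
    both. *)
Definition proves_rel : rel {classic term S r} := fun s t => `[< proves T s t >].

Lemma proves_rel_equiv : equiv_class_of proves_rel.
Proof.
split=> [s|s t|t s u].
- by apply/asboolP; apply: proves_refl.
- by apply: asbool_equiv_eq; split; apply: proves_sym.
by move=> /asboolP st /asboolP tu; apply/asboolP; apply: proves_trans st tu.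
Qed.

Canonical proves_equiv_rel := EquivRelPack proves_rel_equiv.

Definition term_model := {eq_quot proves_rel}%qT.
HB.instance Definition _ := Choice.on term_model.

Definition term_class (t : term S r) : term_model :=
  (\pi_({eq_quot proves_rel}) (t : {classic term S r}))%qT.
Definition term_repr (u : term_model) : term S r := repr (u : {eq_quot proves_rel}%qT).

Lemma term_reprK : cancel term_repr term_class.
Proof. exact: reprK. Qed.

Lemma term_classP s t : term_class s = term_class t <-> proves T s t.
Proof.
split=> [/eqquotP/asboolP //|st].
by apply/eqquotP/asboolP.
Qed.

Lemma term_classK t : proves T (term_repr (term_class t)) t.
Proof. by apply/term_classP; rewrite term_reprK. Qed.

(** Operations act on chosen representatives; by [proves_app] the choice does not affect the
    class. *)
Definition term_interp (f : op S) (a : 'I_(op_arity f) -> term_model) :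
    term_model :=
  term_class (App f (fun i => term_repr (a i))).

Lemma eval_term_class m (rho : 'I_m -> term S r) (t : term S m) :
  eval term_interp (fun i => term_class (rho i)) t = term_class (subst t rho).
Proof.
elim: t => [//|f args IH] /=; apply/term_classP; apply: proves_app => i.
by rewrite IH; apply: term_classK.
Qed.

(** Every valuation in the model comes from a substitution by representatives, so the substitution
    rule applies. *)
Lemma term_model_sound m (s t : term S m) (a : 'I_m -> term_model) :
  proves T s t -> eval term_interp a s = eval term_interp a t.
Proof.
move=> st; have -> : a = fun i => term_class (term_repr (a i)).
  by apply/funext => i; rewrite term_reprK.
by rewrite !eval_term_class; apply/term_classP/proves_subst.
Qed.

(** Under the generic valuation each term evaluates to its own class. *)
Lemma term_model_complete (s t : term S r) :
  eval term_interp (fun i => term_class (Var i)) s =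
  eval term_interp (fun i => term_class (Var i)) t -> proves T s t.
Proof.
have substV (u : term S r) : subst u Var = u.
  by elim: u => [//|f args IH] /=; congr App; apply/funext.
by rewrite !eval_term_class !substV => /term_classP.
Qed.

End TermModel.

(** * The ring structure on the term model and completeness for rings *)

Section RingTermModel.
Variables (T : theory ring_sig) (r : nat).
Hypothesis T_ring : forall m (s t : ring_term m), ring_theory s t -> T s t.

(* The unused argument lets the ring instance depend on a proof that [T]
   contains the ring axioms. *)
Definition ring_term_model of
  (forall m (s t : ring_term m), ring_theory s t -> T s t) := term_model T r.
Local Notation Q := (ring_term_model T_ring).
HB.instance Definition _ := Choice.on Q.

Let I : forall f : op ring_sig, ('I_(op_arity f) -> Q) -> Q :=
  @term_interp ring_sig T r.
Let zero : Q := @I OpZero (tnth [tuple]).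
Let one : Q := @I OpOne (tnth [tuple]).
Let opp (u : Q) : Q := @I OpOpp (tnth [tuple u]).
Let add (u v : Q) : Q := @I OpAdd (tnth [tuple u; v]).
Let mul (u v : Q) : Q := @I OpMul (tnth [tuple u; v]).

(** Arguments of an operation are functions on ordinals; extensionality identifies them with
    tuples. *)
Let interp0 a : @I OpZero a = zero.
Proof. by congr I; apply/funext => -[]. Qed.
Let interp1 a : @I OpOne a = one.
Proof. by congr I; apply/funext => -[]. Qed.
Let interpN a : @I OpOpp a = opp (a ord0).
Proof. by congr I; apply/funext => i; rewrite ord1. Qed.
Let tnth_pair (a : 'I_2 -> Q) : a = tnth [tuple a ord0; a ord_max].
Proof.
by apply/funext => -[[|[|//]] lt_i2]; rewrite (tnth_nth (a ord0)) /=;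
  congr (a _); apply/val_inj.
Qed.
Let interpD a : @I OpAdd a = add (a ord0) (a ord_max).
Proof. by rewrite [in LHS](tnth_pair a). Qed.
Let interpM a : @I OpMul a = mul (a ord0) (a ord_max).
Proof. by rewrite [in LHS](tnth_pair a). Qed.
Let interpE := (interp0, interp1, interpN, interpD, interpM).

Let eval0 m (a : 'I_m -> Q) : eval I a 0%rt = zero.
Proof. exact: interp0. Qed.
Let eval1 m (a : 'I_m -> Q) : eval I a 1%rt = one.
Proof. exact: interp1. Qed.
Let evalN m (a : 'I_m -> Q) (t : ring_term m) :
  eval I a (- t)%rt = opp (eval I a t).
Proof. exact: interpN. Qed.
Let evalD m (a : 'I_m -> Q) (s t : ring_term m) :
  eval I a (s + t)%rt = add (eval I a s) (eval I a t).
Proof. exact: interpD. Qed.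
Let evalM m (a : 'I_m -> Q) (s t : ring_term m) :
  eval I a (s * t)%rt = mul (eval I a s) (eval I a t).
Proof. exact: interpM. Qed.
Let evalE := (eval0, eval1, evalN, evalD, evalM).

Let sound m (s t : ring_term m) (a : 'I_m -> Q) :
  ring_theory s t -> eval I a s = eval I a t.
Proof. by move=> /T_ring/proves_axiom; apply: term_model_sound. Qed.

(** This law and the following ones are the axioms read at a tuple of classes. *)
Let addA : associative add.
Proof.
move=> u v w; have := sound (tnth [tuple u; v; w]) ring_addA.
rewrite !evalE; exact.
Qed.
Let addC : commutative add.
Proof.
move=> u v; have := sound (tnth [tuple u; v]) ring_addC; rewrite !evalE; exact.
Qed.
Let add0 : left_id zero add.
Proof.
move=> u; have := sound (tnth [tuple u]) ring_add0; rewrite !evalE; exact.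
Qed.
Let addN : left_inverse zero opp add.
Proof.
move=> u; have := sound (tnth [tuple u]) ring_addN; rewrite !evalE; exact.
Qed.
Let mulA : associative mul.
Proof.
move=> u v w; have := sound (tnth [tuple u; v; w]) ring_mulA.
rewrite !evalE; exact.
Qed.
Let mul1l : left_id one mul.
Proof.
move=> u; have := sound (tnth [tuple u]) ring_mul1l; rewrite !evalE; exact.
Qed.
Let mul1r : right_id one mul.
Proof.
move=> u; have := sound (tnth [tuple u]) ring_mul1r; rewrite !evalE; exact.
Qed.
Let mulDl : left_distributive mul add.
Proof.
move=> u v w; have := sound (tnth [tuple u; v; w]) ring_mulDl.
rewrite !evalE; exact.
Qed.
Let mulDr : right_distributive mul add.
Proof.
move=> u v w; have := sound (tnth [tuple u; v; w]) ring_mulDr.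
rewrite !evalE; exact.
Qed.

HB.instance Definition _ := GRing.isPzRing.Build Q
  addA addC add0 addN mulA mul1l mul1r mulDl mulDr.

Lemma reval_ring_term_model m (a : 'I_m -> Q) (t : ring_term m) :
  reval a t = eval (@term_interp ring_sig T r) a t.
Proof.
rewrite /reval; suff -> : @ring_interp Q = I by [].
apply: functional_extensionality_dep => f; apply/funext => b.
by case: f b => b; rewrite ?interpE.
Qed.

End RingTermModel.

(** Birkhoff completeness: validity is used only in the term model on [r] variables, at the generic
    valuation. *)
Theorem ring_theory_complete (T : theory ring_sig) (r : nat) (s t : ring_term r) :
  (forall m (u v : ring_term m), ring_theory u v -> T m u v) ->
  (forall A : pzRingType,
     (forall m (u v : ring_term m) (a : 'I_m -> A), T m u v -> reval a u = reval a v) ->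
     forall a : 'I_r -> A, reval a s = reval a t) ->
  proves T s t.
Proof.
move=> T_ring valid; apply: term_model_complete.
have := valid (ring_term_model r T_ring) _ (fun i => term_class T (Var i)).
rewrite !reval_ring_term_model; apply=> m u v a Tuv.
by rewrite !reval_ring_term_model; apply/term_model_sound/proves_axiom.
Qed.

Section Reval.
Variables (A : pzRingType) (r : nat) (a : 'I_r -> A).

Lemma reval_exp (t : ring_term r) n : reval a (t ^+ n)%rt = reval a t ^+ n.
Proof. by elim: n => [//|n IH]; rewrite exprS -IH. Qed.

Lemma reval_natmul (t : ring_term r) n : reval a (t *+ n)%rt = reval a t *+ n.
Proof. by elim: n => [//|n IH]; rewrite mulrS -IH. Qed.

End Reval.

Theorem theorem1p3 (p : nat) (p_prime : prime p) :
  (exists (k : nat) (c : 'I_k -> int) (e : 'I_k -> ring_term 1),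
     forall A : pzRingType, n_ring p A -> p%:R = 0 :> A ->
     forall x : A,
       (forall i : 'I_k, idempotent_elt (reval (fun _ => x) (e i))) /\
       x = \sum_(i < k) reval (fun _ => x) (e i) *~ c i)
  /\
  proves (p_ring_theory p)
    (@tvar 2 0 isT * @tvar 2 1 isT)%rt (@tvar 2 1 isT * @tvar 2 0 isT)%rt.
Proof.
split.
  (* The witnesses are terms fixed before [A] and [x]; this uniformity is what makes the combination
     explicit. *)
  exists p, (fun i => i%:Z).
  exists (fun i => 1 + - (@tvar 1 0 isT + - (1 *+ i)) ^+ p.-1)%rt.
  move=> A nA pA x.
  have evalE (i : 'I_p) : reval (fun=> x)
      (1 + - (@tvar 1 0 isT + - (1 *+ i)) ^+ p.-1)%rt
    = 1 - (x - i%:R) ^+ p.-1.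
    transitivity
      (1 - reval (fun=> x) ((@tvar 1 0 isT + - (1 *+ i)) ^+ p.-1)%rt) => //.
    rewrite reval_exp.
    transitivity (1 - (x - reval (fun=> x) (1 *+ i : ring_term 1)%rt) ^+ p.-1) => //.
    by rewrite reval_natmul.
  split=> [i|].
    by rewrite evalE; apply: idempotent_compl; apply: n_ring_idempotent_exp.
  by under eq_bigr do rewrite evalE; apply: idempotent_decomposition.
(* By completeness it suffices to commute two elements in each ring satisfying the axioms, which is
   a [p]-ring with [p = 0]. *)
apply: ring_theory_complete => [m u v|A modelA a]; first exact: p_ring_ring.
apply: (@p_ring_comm p A (a _) (a _) p_prime).
  split=> [|x]; first exact: prime_gt1.
  by have := modelA _ _ _ (fun=> x) (p_ring_exp p); rewrite reval_exp.
by have := modelA _ _ _ (tnth [tuple]) (p_ring_char p); rewrite reval_natmul.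
Qed.
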